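(* For every positive integer $n$ there are isomorphisms of $\mathfrak{sp}(4,\mathbb{C})$-modules $$(\pi_{nl},\mathcal{F}^+_n)\simeq(\pi_{nr},\mathcal{G}^+_n)\qquad\text{and}\qquad(\pi_{nl},\mathcal{F}^-_n)\simeq(\pi_{nr},\mathcal{G}^-_n),$$ i.e. the spaces of polynomial left and right $n$-regular functions (regular at the origin, respectively at infinity) become isomorphic after restriction from $\mathfrak{gl}(4,\mathbb{C})$ to $\mathfrak{sp}(4,\mathbb{C})$.
   Context: Let $\mathbb{H}_{\mathbb{C}}$ be the algebra of complex $2\times2$ matrices $Z=\begin{pmatrix} z_{11} & z_{12} \\ z_{21} & z_{22} \end{pmatrix}$, $N(Z)=\det Z$. Let $\mathbb{S}=\mathbb{C}^2$ (columns, left $\mathbb{H}_{\mathbb{C}}$-module) and $\mathbb{S}'=\mathbb{C}^2$ (rows, right $\mathbb{H}_{\mathbb{C}}$-module). Write $\partial_{ij}=\partial/\partial z_{ij}$, $\partial=\begin{pmatrix} \partial_{11} & \partial_{21} \\ \partial_{12} & \partial_{22} \end{pmatrix}$ and $\nabla^+=2\begin{pmatrix} \partial_{22} & -\partial_{21} \\ -\partial_{12} & \partial_{11} \end{pmatrix}$. For an operator or matrix $X$ let $X_{(k)}=1\otimes\cdots\otimes X\otimes\cdots\otimes1$ ($X$ in the $k$-th of $n$ tensor factors). A function $f$ with values in the $n$-th symmetric power $\mathbb{S}^{\odot n}\subset\mathbb{S}^{\otimes n}$ is left $n$-regular if $\nabla^+_{(k)}f=0$ for $k=1,\dots,n$;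 a function $g$ with values in $\mathbb{S}'^{\odot n}$ is right $n$-regular if $g\overleftarrow{\nabla^+_{(k)}}=0$ (operator applied, with matrix multiplication, on the right) for $k=1,\dots,n$. $\mathcal{F}^+_n$ is the space of left $n$-regular $f\in\mathbb{S}^{\odot n}\otimes\mathbb{C}[z_{11},z_{12},z_{21},z_{22}]$; $\mathcal{F}^-_n$ is the space of $f\in\mathbb{S}^{\odot n}\otimes\mathbb{C}[z_{11},z_{12},z_{21},z_{22},N(Z)^{-1}]$ such that $N(Z)^{-1}(Z^{-1})^{\otimes n}f(Z^{-1})\in\mathcal{F}^+_n$. $\mathcal{G}^+_n$ is the space of right $n$-regular $g\in\mathbb{S}'^{\odot n}\otimes\mathbb{C}[z_{11},z_{12},z_{21},z_{22}]$; $\mathcal{G}^-_n$ is the space of $g\in\mathbb{S}'^{\odot n}\otimes\mathbb{C}[z_{ij},N(Z)^{-1}]$ such that $N(Z)^{-1}g(Z^{-1})(Z^{-1})^{\otimes n}\in\mathcal{G}^+_n$. The Lie algebra $\mathfrak{gl}(2,\mathbb{H}_{\mathbb{C}})=\mathfrak{gl}(4,\mathbb{C})$, with elements written as $2\times2$ blocks $\begin{pmatrix} A & B \\ C & D \end{pmatrix}$, acts on left $n$-regular functions by $\pi_{nl}(A)f=-\mathrm{Tr}(AZ\partial)f$, $\pi_{nl}(B)f=-\mathrm{Tr}(B\partial)f$, $\pi_{nl}(C)f=\mathrm{Tr}(ZCZ\partial+CZ)f+\sum_k(CZ)_{(k)}f$, $\pi_{nl}(D)f=\mathrm{Tr}(ZD\partial+D)f+\sum_kD_{(k)}f$,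 and on right $n$-regular functions by $\pi_{nr}(A)g=-\mathrm{Tr}(AZ\partial+A)g-\sum_k gA_{(k)}$, $\pi_{nr}(B)g=-\mathrm{Tr}(B\partial)g$, $\pi_{nr}(C)g=\mathrm{Tr}(ZCZ\partial+ZC)g+\sum_k g(ZC)_{(k)}$, $\pi_{nr}(D)g=\mathrm{Tr}(ZD\partial)g$ (here $A$ stands for $\begin{pmatrix} A & 0 \\ 0 & 0 \end{pmatrix}$, etc.). The spaces $\mathcal{F}^\pm_n$, $\mathcal{G}^\pm_n$ are invariant. The subalgebra is $\mathfrak{sp}(4,\mathbb{C})=\left\{\begin{pmatrix} A & B \\ C & -A^T \end{pmatrix}:\ B^T=B,\ C^T=C\right\}\subset\mathfrak{gl}(4,\mathbb{C})$. *)

(* Defs.v *)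
From mathcomp Require Import all_boot perm all_algebra.
From mathcomp Require Import generic_quotient fraction mpoly ring.

Set Implicit Arguments.
Unset Strict Implicit.
Unset Printing Implicit Defensive.

Import GRing.Theory.
Local Open Scope ring_scope.
Local Open Scope quotient_scope.

(* All function spaces live in the field of rational functions in the four
   coordinates z_ij; C[z_ij] and C[z_ij, N(Z)^-1] are carved out of it by
   [is_poly] and [is_poly_Ninv].  The indices 1, 2 of the entries of a 2x2
   matrix are 0, 1 : 'I_2. *)
Section RationalFunctions.
Variable F : fieldType.

Definition polyZ := {mpoly F[2 * 2]}.
Definition ratZ := {fraction polyZ}.

Definition toRat (p : polyZ) : ratZ := FracField.tofrac p.
Definition cst (c : F) : ratZ := toRat c%:MP.
Definition cmx m n (A : 'M[F]_(m, n)) : 'M[ratZ]_(m, n) := map_mx cst A.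

Definition numer (x : ratZ) : polyZ := \n_(repr x).
Definition denom (x : ratZ) : polyZ := \d_(repr x).

Definition Zmx : 'M[ratZ]_2 := \matrix_(i, j) toRat 'X_(mxvec_index i j).
Definition NZ : ratZ := \det Zmx.

(* The partial derivative d/dz_ij, extended to fractions by the quotient rule
   (see [ddz_frac] for independence of the chosen representative). *)
Definition ddz (i j : 'I_2) (x : ratZ) : ratZ :=
  toRat ((numer x)^`M(mxvec_index i j) * denom x
         - numer x * (denom x)^`M(mxvec_index i j)) / toRat (denom x) ^+ 2.

(* Composition x(W) with a matrix W of rational functions; it is meaningful
   when the denominator of x does not vanish at W (see [subst_frac]), which is
   always so for W = Z^-1, the only use below. *)
Definition substp (W : 'M[ratZ]_2) (p : polyZ) : ratZ :=
  mmap cst (fun k => mxvec W 0 k) p.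
Definition subst (W : 'M[ratZ]_2) (x : ratZ) : ratZ :=
  substp W (numer x) / substp W (denom x).

Definition is_poly (x : ratZ) : Prop := exists p : polyZ, x = toRat p.
Definition is_poly_Ninv (x : ratZ) : Prop :=
  exists (p : polyZ) (k : nat), x = toRat p / NZ ^+ k.

(* Tr (M partial) x; the matrix partial is the transpose of (d/dz_ij). *)
Definition trD (M : 'M[ratZ]_2) (x : ratZ) : ratZ :=
  \sum_i \sum_j M i j * ddz i j x.

(* Entry (i, j) of the operator matrix nabla^+. *)
Definition nablap (i j : 'I_2) (x : ratZ) : ratZ :=
  2%:R * (if i == 0 then (if j == 0 then ddz 1 1 x else - ddz 1 0 x)
          else (if j == 0 then - ddz 0 1 x else ddz 0 0 x)).

End RationalFunctions.

(* Functions with values in the n-th tensor power of S (or of S'), given by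
   their components in the standard basis e_(i 0) (x) ... (x) e_(i n-1). *)
Definition tensor (F : fieldType) (n : nat) : Type :=
  {ffun {ffun 'I_n -> 'I_2} -> ratZ F}.

Section Tensors.
Variables (F : fieldType) (n : nat).
Local Notation K := (ratZ F).
Local Notation T := (tensor F n).
Local Notation index := {ffun 'I_n -> 'I_2}.

Definition upd (i : index) (k : 'I_n) (j : 'I_2) : index :=
  [ffun l => if l == k then j else i l].

Definition tadd (f g : T) : T := [ffun i => f i + g i].
Definition tscale (x : K) (f : T) : T := [ffun i => x * f i].
Definition tmap (h : K -> K) (f : T) : T := [ffun i => h (f i)].

(* M_(k) f  and  g M_(k): M acts on the k-th tensor factor. *)
Definition actl (M : 'M[K]_2) (k : 'I_n) (f : T) : T :=
  [ffun i : index => \sum_j M (i k) j * f (upd i k j)].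
Definition actr (M : 'M[K]_2) (k : 'I_n) (g : T) : T :=
  [ffun i : index => \sum_j g (upd i k j) * M j (i k)].

(* M^{(x) n} f  and  g M^{(x) n} *)
Definition tpowl (M : 'M[K]_2) (f : T) : T :=
  [ffun i : index => \sum_(j : index) (\prod_k M (i k) (j k)) * f j].
Definition tpowr (M : 'M[K]_2) (g : T) : T :=
  [ffun i : index => \sum_(j : index) g j * (\prod_k M (j k) (i k))].

Definition symmetric_tensor (f : T) : Prop :=
  forall (s : 'S_n) (i : index), f [ffun k => i (s k)] = f i.

Definition left_regular (f : T) : Prop :=
  symmetric_tensor f /\
  forall (k : 'I_n) (i : index), \sum_j nablap (i k) j (f (upd i k j)) = 0.
Definition right_regular (g : T) : Prop :=
  symmetric_tensor g /\
  forall (k : 'I_n) (i : index), \sum_j nablap j (i k) (g (upd i k j)) = 0.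

Definition Fplus (f : T) : Prop :=
  (forall i, is_poly (f i)) /\ left_regular f.
Definition Gplus (g : T) : Prop :=
  (forall i, is_poly (g i)) /\ right_regular g.

Definition Fminus (f : T) : Prop :=
  [/\ symmetric_tensor f, forall i, is_poly_Ninv (f i) &
      Fplus (tscale (NZ F)^-1
        (tpowl (invmx (Zmx F)) (tmap (subst (invmx (Zmx F))) f)))].
Definition Gminus (g : T) : Prop :=
  [/\ symmetric_tensor g, forall i, is_poly_Ninv (g i) &
      Gplus (tscale (NZ F)^-1
        (tpowr (invmx (Zmx F)) (tmap (subst (invmx (Zmx F))) g)))].

Local Notation Z := (Zmx F).

Definition pi_nl_A (A : 'M[F]_2) (f : T) : T :=
  [ffun i => - trD (cmx A *m Z) (f i)].
Definition pi_nl_B (B : 'M[F]_2) (f : T) : T :=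
  [ffun i => - trD (cmx B) (f i)].
Definition pi_nl_C (C : 'M[F]_2) (f : T) : T :=
  [ffun i => trD (Z *m cmx C *m Z) (f i) + \tr (cmx C *m Z) * f i
             + \sum_k actl (cmx C *m Z) k f i].
Definition pi_nl_D (D : 'M[F]_2) (f : T) : T :=
  [ffun i => trD (Z *m cmx D) (f i) + \tr (cmx D) * f i
             + \sum_k actl (cmx D) k f i].

Definition pi_nr_A (A : 'M[F]_2) (g : T) : T :=
  [ffun i => - (trD (cmx A *m Z) (g i) + \tr (cmx A) * g i)
             - \sum_k actr (cmx A) k g i].
Definition pi_nr_B (B : 'M[F]_2) (g : T) : T :=
  [ffun i => - trD (cmx B) (g i)].
Definition pi_nr_C (C : 'M[F]_2) (g : T) : T :=
  [ffun i => trD (Z *m cmx C *m Z) (g i) + \tr (Z *m cmx C) * g i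
             + \sum_k actr (Z *m cmx C) k g i].
Definition pi_nr_D (D : 'M[F]_2) (g : T) : T :=
  [ffun i => trD (Z *m cmx D) (g i)].

Definition pi_nl (X : 'M[F]_(2 + 2)) (f : T) : T :=
  tadd (tadd (pi_nl_A (ulsubmx X) f) (pi_nl_B (ursubmx X) f))
       (tadd (pi_nl_C (dlsubmx X) f) (pi_nl_D (drsubmx X) f)).
Definition pi_nr (X : 'M[F]_(2 + 2)) (g : T) : T :=
  tadd (tadd (pi_nr_A (ulsubmx X) g) (pi_nr_B (ursubmx X) g))
       (tadd (pi_nr_C (dlsubmx X) g) (pi_nr_D (drsubmx X) g)).

End Tensors.

Definition sp4 (F : fieldType) (X : 'M[F]_(2 + 2)) : Prop :=
  exists A B C : 'M[F]_2,
    [/\ X = block_mx A B C (- A^T), B^T = B & C^T = C].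

(* The subspaces V and W, with the actions piV and piW, are isomorphic as
   sp(4)-modules: there is an F-linear sp(4)-equivariant bijection from V to W.
   The map phi matters only on V, which is stable under piV. *)
Definition sp4_isomorphic (F : fieldType) (n : nat)
    (piV : 'M[F]_(2 + 2) -> tensor F n -> tensor F n) (V : tensor F n -> Prop)
    (piW : 'M[F]_(2 + 2) -> tensor F n -> tensor F n) (W : tensor F n -> Prop)
    : Prop :=
  exists phi : tensor F n -> tensor F n,
    [/\ forall f, V f -> W (phi f),
        forall f1 f2, V f1 -> V f2 -> phi f1 = phi f2 -> f1 = f2,
        forall g, W g -> exists2 f, V f & phi f = g,
        forall (c : F) f1 f2, V f1 -> V f2 ->
          phi (tadd (tscale (cst c) f1) f2)
          = tadd (tscale (cst c) (phi f1)) (phi f2) &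
        forall X, sp4 X -> forall f, V f -> phi (piV X f) = piW X (phi f)].

Section WellDefined.
Variable F : fieldType.
Local Notation toRat := (@toRat F).

Lemma toRat_eq0 (p : polyZ F) : (toRat p == 0) = (p == 0).
Proof. exact: tofrac_eq0. Qed.

Lemma denom_neq0 (x : ratZ F) : denom x != 0.
Proof. exact: denom_ratioP. Qed.

Lemma pi_Ratio (R : idomainType) (a b : R) : b != 0 ->
  \pi_({fraction R}) (Ratio a b) = FracField.tofrac a / FracField.tofrac b.
Proof.
move=> b0; rewrite -[RHS]/(FracField.mul _ (FracField.inv _)).
unlock FracField.tofrac.
rewrite -FracField.pi_inv -FracField.pi_mul /FracField.invf /FracField.mulf.
by rewrite !numden_Ratio ?oner_eq0 // mulr1 mul1r.
Qed.

Lemma ratZ_numer_denom (x : ratZ F) : x = toRat (numer x) / toRat (denom x).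
Proof.
rewrite -[LHS]reprK -[repr x in LHS]FracField.Ratio_numden.
by rewrite pi_Ratio ?denom_neq0.
Qed.

Lemma numer_denom (p q : polyZ F) : q != 0 ->
  numer (toRat p / toRat q) * q = p * denom (toRat p / toRat q).
Proof.
move=> q0; have := ratZ_numer_denom (toRat p / toRat q).
move: (numer _) (denom _) (denom_neq0 (toRat p / toRat q)) => a b b0 /eqP.
rewrite eqr_div ?toRat_eq0 // /toRat -!tofracM tofrac_eq => /eqP ->.
by [].
Qed.

Lemma ddz_frac i j (p q : polyZ F) : q != 0 ->
  ddz i j (toRat p / toRat q)
  = toRat (p^`M(mxvec_index i j) * q - p * q^`M(mxvec_index i j))
    / toRat q ^+ 2.
Proof.
move=> q0; rewrite /ddz; set x := toRat p / toRat q; set k := mxvec_index i j.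
have e : numer x * q = p * denom x by exact: numer_denom.
have d0 := denom_neq0 x.
move: (numer x) (denom x) e d0 => a b e d0.
have e' : a^`M(k) * q + a * q^`M(k) = p^`M(k) * b + p * b^`M(k).
  by rewrite -!mderivM e.
apply/eqP; rewrite eqr_div ?expf_eq0 ?toRat_eq0 //.
rewrite /toRat -!tofracXn -!tofracM tofrac_eq; apply/eqP.
have {}e' : (a^`M(k) * q) * (b * q)
    = (p^`M(k) * b + p * b^`M(k) - a * q^`M(k)) * (b * q).
  by rewrite -e' addrK.
have e1 : a * q * (b^`M(k) * q) = p * b * (b^`M(k) * q) by rewrite e.
have e2 : a * q * (q^`M(k) * b) = p * b * (q^`M(k) * b) by rewrite e.
have -> : (a^`M(k) * b - a * b^`M(k)) * q ^+ 2
    = (a^`M(k) * q) * (b * q) - a * q * (b^`M(k) * q) by ring.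
rewrite e' e1.
transitivity (p^`M(k) * q * b ^+ 2 - a * q * (q^`M(k) * b)); first by ring.
by rewrite e2; ring.
Qed.

Lemma substpM (W : 'M[ratZ F]_2) : {morph substp W : p q / p * q}.
Proof.
exact: (rmorphM (mmap (@FracField.tofrac _ \o @mpolyC _ F) _)).
Qed.

Lemma subst_frac (W : 'M[ratZ F]_2) (p q : polyZ F) :
  (forall r, r != 0 -> substp W r != 0) -> q != 0 ->
  subst W (toRat p / toRat q) = substp W p / substp W q.
Proof.
move=> W0 q0; apply/eqP; rewrite /subst eqr_div ?W0 ?denom_neq0 //.
have /(congr1 (substp W)) := numer_denom p q0.
by rewrite !substpM => ->.
Qed.

End WellDefined.

(* Main.v *)
(* The isomorphism is f(Z) |-> f(Z^T)^T, in both cases.  Transposition of Z turns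
   nabla^+ into its transpose and commutes with Z |-> Z^-1, so it exchanges left
   and right regular functions.  It sends pi_nl of (A, B, C, D) to pi_nr of
   (-D^T, B^T, C^T, -A^T), which is the same element exactly on sp(4). *)
Require Import Defs.
From HB Require Import structures.
From mathcomp Require Import all_boot all_algebra reals.
From mathcomp Require Import fraction mpoly.
From mathcomp Require Import complex.

Set Implicit Arguments.
Unset Strict Implicit.
Unset Printing Implicit Defensive.

Import GRing.Theory.
Local Open Scope ring_scope.
Local Open Scope complex_scope.

(** Reduces identities between ring morphisms, or between twisted derivations, to constants and
    single variables. *)
Lemma mpoly_ring_ind (n : nat) (R : comNzRingType) (P : {mpoly R[n]} -> Prop) :
  (forall c, P c%:MP) -> (forall k, P 'X_k) ->
  (forall p q, P p -> P q -> P (p + q)) ->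
  (forall p q, P p -> P q -> P (p * q)) ->
  forall p, P p.
Proof.
move=> PC PX PD PM p; rewrite [p]mpolyE.
apply: (big_ind P) => [|//|m _]; first by rewrite -mpolyC0.
rewrite -mul_mpolyC mpolyXE_id; apply: (PM) => //.
apply: (big_ind P) => [|//|k _]; first by rewrite -mpolyC1.
elim: (m k) => [|j IH]; first by rewrite expr0 -mpolyC1.
by rewrite exprS; apply: PM.
Qed.

Lemma adj_unitmx (K : fieldType) m (A : 'M[K]_m) :
  A \in unitmx -> \adj A = \det A *: invmx A.
Proof.
move=> uA; rewrite /invmx uA scalerA mulfV ?scale1r //.
by rewrite -unitfE -unitmxE.
Qed.

(** * Evaluation of polynomials and fractions at a matrix [W] *)

Section Substitution.
Variable F : fieldType.
Local Notation K := (ratZ F).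
Local Notation Z := (Zmx F).

HB.instance Definition _ :=
  GRing.RMorphism.copy (@toRat F) (@FracField.tofrac (polyZ F)).

Lemma cst_is_zmod_morphism : zmod_morphism (@cst F).
Proof. by move=> a b; rewrite /cst mpolyCB rmorphB. Qed.

Lemma cst_is_monoid_morphism : monoid_morphism (@cst F).
Proof. by split=> [|a b]; rewrite /cst ?mpolyCM ?rmorphM ?mpolyC1 ?rmorph1. Qed.

HB.instance Definition _ :=
  GRing.isZmodMorphism.Build F K (@cst F) cst_is_zmod_morphism.
HB.instance Definition _ :=
  GRing.isMonoidMorphism.Build F K (@cst F) cst_is_monoid_morphism.

HB.instance Definition _ (W : 'M[K]_2) :=
  GRing.RMorphism.copy (@substp F W) (mmap (@cst F) (fun k => mxvec W 0 k)).

Lemma substpC (W : 'M[K]_2) (c : F) : substp W c%:MP = cst c.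
Proof. exact: mmapC. Qed.

Lemma substpX (W : 'M[K]_2) i j : substp W 'X_(mxvec_index i j) = W i j.
Proof. by rewrite /substp mmapX mmap1U mxvecE. Qed.

Lemma toRat_neq0 (p : polyZ F) : (toRat p != 0) = (p != 0).
Proof. by rewrite toRat_eq0. Qed.

Lemma ZmxE i j : Z i j = toRat 'X_(mxvec_index i j).
Proof. by rewrite mxE. Qed.

(** Quantifying over every nonzero denominator, not just the chosen representative, gives the form
    to which [ddz_frac] and [subst_frac] apply. *)
Lemma ratZ_ind (P : K -> Prop) :
  (forall p q : polyZ F, q != 0 -> P (toRat p / toRat q)) -> forall x, P x.
Proof. by move=> h x; rewrite (ratZ_numer_denom x); apply/h/denom_neq0. Qed.

Section NonvanishingSubstitution.
Variable W : 'M[K]_2.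
Hypothesis W0 : forall r : polyZ F, r != 0 -> substp W r != 0.

Lemma subst_toRat p : subst W (toRat p) = substp W p.
Proof.
have := subst_frac (W := W) p W0 (oner_neq0 _).
by rewrite !rmorph1 !divr1.
Qed.

Lemma substD : {morph subst W : x y / x + y}.
Proof.
elim/ratZ_ind=> p q q0; elim/ratZ_ind=> p' q' q'0.
rewrite addf_div ?toRat_neq0 // -!rmorphM -rmorphD !subst_frac ?mulf_neq0 //.
by rewrite addf_div ?W0 // rmorphD !rmorphM.
Qed.

Lemma substM : {morph subst W : x y / x * y}.
Proof.
elim/ratZ_ind=> p q q0; elim/ratZ_ind=> p' q' q'0.
by rewrite mulf_div -!rmorphM !subst_frac ?mulf_neq0 // mulf_div !rmorphM.
Qed.

End NonvanishingSubstitution.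

End Substitution.

(** * Transposition of the variable [Z] *)

Section Transposition.
Variable F : fieldType.
Local Notation K := (ratZ F).
Local Notation Z := (Zmx F).

(** The row of all indices is reshaped into a matrix, transposed and flattened again, which avoids
    arithmetic on the encoding of pairs. *)
Definition tr_index (k : 'I_(2 * 2)) : 'I_(2 * 2) :=
  mxvec (vec_mx (\row_l l))^T 0 k.

Lemma tr_indexE i j : tr_index (mxvec_index i j) = mxvec_index j i.
Proof. by rewrite /tr_index mxvecE !mxE. Qed.

Lemma tr_indexK : involutive tr_index.
Proof. by case/mxvec_indexP=> i j; rewrite !tr_indexE. Qed.

Definition tr_poly (p : polyZ F) : polyZ F :=
  mmap (@mpolyC (2 * 2) F) (fun k => 'X_(tr_index k)) p.

HB.instance Definition _ := GRing.RMorphism.copy tr_poly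
  (mmap (@mpolyC (2 * 2) F) (fun k => 'X_(tr_index k))).

Lemma tr_polyC (c : F) : tr_poly c%:MP = c%:MP.
Proof. exact: mmapC. Qed.

Lemma tr_polyX i j : tr_poly 'X_(mxvec_index i j) = 'X_(mxvec_index j i).
Proof. by rewrite /tr_poly mmapX mmap1U tr_indexE. Qed.

Lemma tr_polyK : involutive tr_poly.
Proof.
elim/mpoly_ring_ind => [c|k|p q hp hq|p q hp hq].
- by rewrite !tr_polyC.
- by case/mxvec_indexP: k => i j; rewrite !tr_polyX.
- by rewrite !rmorphD /= hp hq.
- by rewrite !rmorphM /= hp hq.
Qed.

Lemma tr_poly_neq0 p : (tr_poly p != 0) = (p != 0).
Proof. by rewrite -[in LHS](rmorph0 tr_poly) (inj_eq (inv_inj tr_polyK)). Qed.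

(** Chain rule for a permutation of the variables: both sides obey the same Leibniz rule twisted by
    [tr_poly], so constants and variables decide. *)
Lemma mderiv_tr i j p :
  (tr_poly p)^`M(mxvec_index i j) = tr_poly p^`M(mxvec_index j i).
Proof.
elim/mpoly_ring_ind: p => [c|k|p q hp hq|p q hp hq].
- by rewrite tr_polyC !mderivC rmorph0.
- case/mxvec_indexP: k => i' j'; rewrite tr_polyX !mderivX !mnm1E.
  have -> : (mxvec_index j' i' == mxvec_index i j)
          = (mxvec_index i' j' == mxvec_index j i).
    by rewrite -(tr_indexE i' j') -(tr_indexE j i) (inj_eq (inv_inj tr_indexK)).
  (* Both derivatives carry the same Kronecker delta; where it is 1, the variable cancels from its
     own monomial and both sides are 1. *)
  case: eqP => [e|_]; last by rewrite !scale0r rmorph0.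
  have subUU (k : 'I_(2 * 2)) : (U_(k) - U_(k))%MM = 0%MM.
    by apply/mnmP=> l; rewrite mnmBE subnn mnm0E.
  have := congr1 tr_index e; rewrite !tr_indexE e => ->.
  by rewrite !subUU !scale1r mpolyX0 rmorph1.
- by rewrite rmorphD !mderivD rmorphD /= hp hq.
- by rewrite rmorphM !mderivM rmorphD !rmorphM /= hp hq.
Qed.

(** Evaluation at [Z^T] only permutes the variables, so no nonzero polynomial vanishes there and
    [subst Z^T] is a field morphism. *)
Lemma substp_trZ p : substp Z^T p = toRat (tr_poly p).
Proof.
elim/mpoly_ring_ind: p => [c|k|p q hp hq|p q hp hq].
- by rewrite substpC tr_polyC.
- by case/mxvec_indexP: k => i j; rewrite substpX tr_polyX !mxE.
- by rewrite !rmorphD /= hp hq.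
- by rewrite !rmorphM /= hp hq.
Qed.

Lemma substp_trZ_neq0 r : r != 0 -> substp Z^T r != 0.
Proof. by rewrite substp_trZ toRat_neq0 tr_poly_neq0. Qed.

Definition trZ : K -> K := subst Z^T.

Lemma trZ_toRat p : trZ (toRat p) = toRat (tr_poly p).
Proof. by rewrite /trZ subst_toRat ?substp_trZ //; exact: substp_trZ_neq0. Qed.

Lemma trZ_frac p q : q != 0 ->
  trZ (toRat p / toRat q) = toRat (tr_poly p) / toRat (tr_poly q).
Proof.
by move=> q0; rewrite /trZ subst_frac ?substp_trZ //; exact: substp_trZ_neq0.
Qed.

Lemma trZ_is_zmod_morphism : zmod_morphism trZ.
Proof.
have trD : {morph trZ : x y / x + y} := substD substp_trZ_neq0.
by move=> x y; apply: (addIr (trZ y)); rewrite -trD !subrK.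
Qed.

Lemma trZ_is_monoid_morphism : monoid_morphism trZ.
Proof.
split; last exact: (substM substp_trZ_neq0).
by rewrite -(rmorph1 (@toRat F)) trZ_toRat (rmorph1 tr_poly).
Qed.

HB.instance Definition _ :=
  GRing.isZmodMorphism.Build K K trZ trZ_is_zmod_morphism.
HB.instance Definition _ :=
  GRing.isMonoidMorphism.Build K K trZ trZ_is_monoid_morphism.

Lemma trZK : involutive trZ.
Proof.
elim/ratZ_ind => p q q0.
by rewrite !trZ_frac ?tr_poly_neq0 // !tr_polyK.
Qed.

Lemma trZ_cst (c : F) : trZ (cst c) = cst c.
Proof. by rewrite /cst trZ_toRat tr_polyC. Qed.

Lemma map_trZ_cmx m n (A : 'M[F]_(m, n)) : map_mx trZ (cmx A) = cmx A.
Proof. by apply/matrixP=> i j; rewrite !mxE trZ_cst. Qed.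

Lemma map_trZ_Zmx : map_mx trZ Z = Z^T.
Proof. by apply/matrixP=> i j; rewrite !mxE trZ_toRat tr_polyX. Qed.

Lemma trZ_NZ : trZ (NZ F) = NZ F.
Proof. by rewrite /NZ -det_map_mx map_trZ_Zmx det_tr. Qed.

Lemma map_trZ_invZ : map_mx trZ (invmx Z) = (invmx Z)^T.
Proof. by rewrite map_invmx map_trZ_Zmx trmx_inv. Qed.

Lemma trZ_ddz i j x : trZ (ddz i j x) = ddz j i (trZ x).
Proof.
elim/ratZ_ind: x => p q q0.
rewrite trZ_frac // !ddz_frac ?tr_poly_neq0 // -!rmorphXn /=.
rewrite trZ_frac ?expf_neq0 // !mderiv_tr.
by rewrite !(rmorphXn, rmorphB, rmorphM).
Qed.

(** By [trZ_ddz] each derivative has its two indices swapped; exchanging the two sums moves this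
    swap onto the matrix. *)
Lemma trZ_trD M x : trZ (trD M x) = trD (map_mx trZ M)^T (trZ x).
Proof.
rewrite /trD rmorph_sum exchange_big; apply: eq_bigr => i _ /=.
rewrite rmorph_sum; apply: eq_bigr => j _.
by rewrite rmorphM /= trZ_ddz !mxE.
Qed.


Lemma trDN (M : 'M[K]_2) (x : K) : trD (- M) x = - trD M x.
Proof.
rewrite /trD -sumrN; apply: eq_bigr => i _; rewrite -sumrN.
by apply: eq_bigr => j _; rewrite mxE mulNr.
Qed.

Lemma trZ_nablap i j x : trZ (nablap i j x) = nablap j i (trZ x).
Proof.
rewrite /nablap rmorphM rmorph_nat.
by case: (i == 0); case: (j == 0); rewrite /= ?rmorphN /= trZ_ddz.
Qed.

End Transposition.

(** * Inversion of the variable [Z] and its compatibility with transposition *)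

Section InverseSubstitution.
Variable F : fieldType.
Local Notation K := (ratZ F).
Local Notation Z := (Zmx F).

(** A polynomial lift of [Z]: its determinant and adjugate are polynomials, so they can be evaluated
    at any matrix. *)
Definition polyZmx : 'M[polyZ F]_2 := \matrix_(i, j) 'X_(mxvec_index i j).

Lemma map_toRat_polyZmx : map_mx (@toRat F) polyZmx = Z.
Proof. by apply/matrixP=> i j; rewrite !mxE. Qed.

Lemma map_substp_polyZmx W : map_mx (substp W) polyZmx = W.
Proof. by apply/matrixP=> i j; rewrite !mxE substpX. Qed.

Lemma toRat_det_polyZmx : toRat (\det polyZmx) = NZ F.
Proof. by rewrite -det_map_mx map_toRat_polyZmx. Qed.

Lemma substp_det_polyZmx W : substp W (\det polyZmx) = \det W.
Proof. by rewrite -det_map_mx map_substp_polyZmx. Qed.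

Lemma NZ_neq0 : NZ F != 0.
Proof.
rewrite -toRat_det_polyZmx toRat_neq0.
(* At the identity matrix the determinant takes the value 1. *)
apply/eqP => /(congr1 (substp 1%:M)); rewrite substp_det_polyZmx det1 rmorph0.
by move/eqP; rewrite oner_eq0.
Qed.

Lemma Zmx_unit : Z \in unitmx.
Proof. by rewrite unitmxE unitfE NZ_neq0. Qed.

(* Since det (Z^-1) = N^-1, the relation p(Z^-1) N^k = q between polynomials
   can be inverted; this makes substitution of Z^-1 injective. *)
Lemma substp_invZ_trade (p : polyZ F) : exists q k,
  substp (invmx Z) p * NZ F ^+ k = toRat q /\
  substp (invmx Z) q * NZ F ^+ k = toRat p.
Proof.
have N0 := NZ_neq0.
have NV : substp (invmx Z) (\det polyZmx) = (NZ F)^-1.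
  by rewrite substp_det_polyZmx det_inv.
elim/mpoly_ring_ind: p => [c|k|p p' [q [k [e1 e2]]] [q' [k' [e1' e2']]]
                          |p p' [q [k [e1 e2]]] [q' [k' [e1' e2']]]].
- by exists c%:MP, 0%N; rewrite substpC mulr1.
(* Since [Z^-1] is the adjugate divided by [N], one factor [N] clears the denominator. *)
- case/mxvec_indexP: k => i j; exists (\adj polyZmx i j), 1%N.
  rewrite !expr1 substpX; split.
    have -> : toRat (\adj polyZmx i j) = (\adj Z) i j.
      by rewrite -map_toRat_polyZmx -map_mx_adj [RHS]mxE.
    by rewrite (adj_unitmx Zmx_unit) [RHS]mxE mulrC.
  have -> : substp (invmx Z) (\adj polyZmx i j) = (\adj (invmx Z)) i j.
    by rewrite -[in RHS](map_substp_polyZmx (invmx Z)) -map_mx_adj [RHS]mxE.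
  have -> : \adj (invmx Z) = (NZ F)^-1 *: Z.
    by rewrite adj_unitmx ?unitmx_inv ?Zmx_unit // invmxK det_inv.
  by rewrite [X in X * _]mxE -ZmxE mulrAC mulVf // mul1r.
(* The common power is [N^(k + k')]; each traded polynomial takes the other exponent, which becomes
   a negative power of [N] on trading back and cancels. *)
- exists (q * \det polyZmx ^+ k' + q' * \det polyZmx ^+ k), (k + k')%N.
  rewrite !rmorphD !rmorphM !rmorphXn /= NV toRat_det_polyZmx.
  rewrite -e1 -e1' -e2 -e2' !exprD !exprVn.
  have Nk m : NZ F ^+ m != 0 by rewrite expf_neq0.
  split; rewrite mulrDl; congr (_ + _).
  - by rewrite mulrA.
  - by rewrite [_ ^+ k * _]mulrC mulrA.
  - by rewrite [_ ^+ k * _]mulrC mulrA (divfK (Nk _)).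
  - by rewrite mulrA (divfK (Nk _)).
- exists (q * q'), (k + k')%N; rewrite !rmorphM /= -e1 -e1' -e2 -e2' exprD.
  by split; rewrite mulrACA.
Qed.

(** If [r(Z^-1)] is 0, the traded polynomial is 0, and trading back gives [r = 0]. *)
Lemma substp_invZ_neq0 (r : polyZ F) : r != 0 -> substp (invmx Z) r != 0.
Proof.
have [q [k [e1 e2]]] := substp_invZ_trade r.
apply: contraNneq => r0; move: e1 e2; rewrite r0 mul0r => /esym/eqP.
by rewrite toRat_eq0 => /eqP ->; rewrite rmorph0 mul0r => /esym/eqP; rewrite toRat_eq0.
Qed.

(** On the variables this says that the inverse of [Z^T] is the transpose of [Z^-1]. *)
Lemma trZ_substp_invZ (p : polyZ F) :
  trZ (substp (invmx Z) p) = substp (invmx Z) (tr_poly p).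
Proof.
elim/mpoly_ring_ind: p => [c|k|p q hp hq|p q hp hq].
- by rewrite tr_polyC !substpC trZ_cst.
- case/mxvec_indexP: k => i j; rewrite tr_polyX !substpX.
  by have /matrixP/(_ i j) := map_trZ_invZ F; rewrite !mxE.
- by rewrite !rmorphD /= hp hq.
- by rewrite !rmorphM /= hp hq.
Qed.

Lemma trZ_subst_invZ (x : K) :
  trZ (subst (invmx Z) x) = subst (invmx Z) (trZ x).
Proof.
have Zi0 := substp_invZ_neq0.
elim/ratZ_ind: x => p q q0.
rewrite trZ_frac // !subst_frac ?tr_poly_neq0 // fmorph_div.
by rewrite -!trZ_substp_invZ.
Qed.

End InverseSubstitution.

(** * Transposition of tensor-valued functions and the intertwining property *)

Section TensorTransposition.
Variables (F : fieldType) (n : nat).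
Local Notation K := (ratZ F).
Local Notation T := (tensor F n).
Local Notation Z := (Zmx F).

(** A row and a column have the same components, so the outer transposition in [f(Z^T)^T] is
    invisible here. *)
Definition trT : T -> T := tmap (@trZ F).

Lemma trTK : involutive trT.
Proof. by move=> f; apply/ffunP=> i; rewrite !ffunE trZK. Qed.

Lemma trT_tadd f g : trT (tadd f g) = tadd (trT f) (trT g).
Proof. by apply/ffunP=> i; rewrite !ffunE rmorphD. Qed.

Lemma trT_tscale x f : trT (tscale x f) = tscale (trZ x) (trT f).
Proof. by apply/ffunP=> i; rewrite !ffunE rmorphM. Qed.

Lemma trZ_actl (M : 'M[K]_2) k (f : T) i :
  trZ (actl M k f i) = actr (map_mx (@trZ F) M)^T k (trT f) i.
Proof.
rewrite !ffunE rmorph_sum; apply: eq_bigr => j _.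
by rewrite rmorphM mulrC !mxE ffunE.
Qed.

Lemma actrN (M : 'M[K]_2) k (g : T) i : actr (- M) k g i = - actr M k g i.
Proof.
rewrite !ffunE -sumrN; apply: eq_bigr => j _.
by rewrite mxE mulrN.
Qed.

Lemma trT_tpowl M f :
  trT (tpowl M f) = tpowr (map_mx (@trZ F) M)^T (trT f).
Proof.
apply/ffunP=> i; rewrite !ffunE rmorph_sum; apply: eq_bigr => j _.
rewrite rmorphM mulrC ffunE rmorph_prod; congr (_ * _).
by apply: eq_bigr => k _; rewrite !mxE.
Qed.

Lemma is_poly_trZ (x : K) : is_poly (trZ x) <-> is_poly x.
Proof.
(* One direction suffices, because [trZ] is an involution. *)
suff h : forall y : K, is_poly y -> is_poly (trZ y).
  by split=> [/h|/h//]; rewrite trZK.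
by move=> y [p ->]; exists (tr_poly p); rewrite trZ_toRat.
Qed.

Lemma is_poly_Ninv_trZ (x : K) : is_poly_Ninv (trZ x) <-> is_poly_Ninv x.
Proof.
suff h : forall y : K, is_poly_Ninv y -> is_poly_Ninv (trZ y).
  by split=> [/h|/h//]; rewrite trZK.
move=> y [p [k ->]]; exists (tr_poly p), k.
by rewrite fmorph_div rmorphXn /= trZ_toRat trZ_NZ.
Qed.

Lemma symmetric_tensor_trT f :
  symmetric_tensor (trT f) <-> symmetric_tensor f.
Proof.
suff h : forall g : T, symmetric_tensor g -> symmetric_tensor (trT g).
  by split=> [/h|/h//]; rewrite trTK.
by move=> g sg s i; rewrite !ffunE sg.
Qed.

Lemma right_regular_trT f : right_regular (trT f) <-> left_regular f.
Proof.
have e (k : 'I_n) (i : {ffun 'I_n -> 'I_2}) :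
    \sum_j nablap j (i k) (trT f (upd i k j))
    = trZ (\sum_j nablap (i k) j (f (upd i k j))).
  by rewrite rmorph_sum; apply: eq_bigr => j _; rewrite /= ffunE trZ_nablap.
(* The regularity equations correspond under [trZ], which is injective as a field morphism. *)
split=> -[/symmetric_tensor_trT sf rf]; split=> // k i.
  by apply/eqP; rewrite -(fmorph_eq0 (@trZ F)) /= -e rf.
by rewrite e rf rmorph0.
Qed.

Lemma Gplus_trT f : Gplus (trT f) <-> Fplus f.
Proof.
split=> -[pf /right_regular_trT rf]; split=> // i.
  by apply/is_poly_trZ; have := pf i; rewrite ffunE.
by rewrite ffunE; apply/is_poly_trZ.
Qed.

Lemma Gminus_trT f : Gminus (trT f) <-> Fminus f.
Proof.
(* Transposition commutes with the inversion that defines regularity at infinity, so the polynomial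
   case [Gplus_trT] applies. *)
have e : tscale (NZ F)^-1 (tpowr (invmx Z) (tmap (subst (invmx Z)) (trT f)))
  = trT (tscale (NZ F)^-1 (tpowl (invmx Z) (tmap (subst (invmx Z)) f))).
  rewrite trT_tscale trT_tpowl map_trZ_invZ trmxK fmorphV /= trZ_NZ.
  congr (tscale _ (tpowr _ _)).
  by apply/ffunP=> i; rewrite !ffunE trZ_subst_invZ.
rewrite /Gminus e.
split=> -[/symmetric_tensor_trT sf pf /Gplus_trT gf]; split=> // i.
  by apply/is_poly_Ninv_trZ; have := pf i; rewrite ffunE.
by rewrite ffunE; apply/is_poly_Ninv_trZ.
Qed.

Lemma trT_pi_nl X f : sp4 X -> trT (pi_nl X f) = pi_nr X (trT f).
Proof.
case=> A [B [C [-> Bs Cs]]].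
rewrite /pi_nl /pi_nr !(block_mxKul, block_mxKur, block_mxKdl, block_mxKdr).
have cmx_tr (M : 'M[F]_2) : (cmx M)^T = cmx M^T by rewrite /cmx map_trmx.
have cmxN (M : 'M[F]_2) : cmx (- M) = - cmx M by rewrite /cmx map_mxN.
have trZ_tr (M : 'M[K]_2) : trZ (\tr M) = \tr (map_mx (@trZ F) M)^T.
  by rewrite mxtrace_tr trace_map_mx.
have trZ_sum_actl M i : trZ (\sum_k actl M k f i)
    = \sum_k actr (map_mx (@trZ F) M)^T k (trT f) i.
  by rewrite rmorph_sum; apply: eq_bigr => k _; rewrite /= trZ_actl.
(* [AZ] becomes the transpose of [A Z^T], namely [Z A^T]: the blocks [A] and [D] trade places. *)
have eA : trT (pi_nl_A A f) = pi_nr_D (- A^T) (trT f).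
  apply/ffunP=> i; rewrite !ffunE rmorphN /= trZ_trD map_mxM map_trZ_cmx.
  by rewrite map_trZ_Zmx trmx_mul trmxK cmx_tr cmxN mulmxN trDN.
have eB : trT (pi_nl_B B f) = pi_nr_B B (trT f).
  apply/ffunP=> i; rewrite !ffunE rmorphN /= trZ_trD map_trZ_cmx.
  by rewrite cmx_tr Bs.
(* [ZCZ] becomes [Z C^T Z] and [CZ] becomes [Z C^T]; symmetry of [C] removes the transposes. *)
have eC : trT (pi_nl_C C f) = pi_nr_C C (trT f).
  apply/ffunP=> i; rewrite [LHS]ffunE [in LHS]ffunE [RHS]ffunE !rmorphD rmorphM /=.
  rewrite trZ_trD trZ_tr trZ_sum_actl !map_mxM !map_trZ_cmx !map_trZ_Zmx.
  by rewrite !trmx_mul !trmxK !cmx_tr Cs mulmxA [trT f i]ffunE.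
(* With [D = -A^T], [ZD] becomes [D^T Z = -AZ], and the trace and tensor terms change sign in the
   same way. *)
have eD : trT (pi_nl_D (- A^T) f) = pi_nr_A A (trT f).
  apply/ffunP=> i; rewrite [LHS]ffunE [in LHS]ffunE [RHS]ffunE !rmorphD rmorphM /=.
  rewrite trZ_trD trZ_tr trZ_sum_actl !map_mxM !map_trZ_cmx !map_trZ_Zmx.
  rewrite !trmx_mul !trmxK !cmx_tr linearN /= trmxK cmxN mulNmx trDN raddfN /=.
  rewrite mulNr -opprD [trT f i]ffunE -sumrN.
  by congr (_ + _); apply: eq_bigr => k _; rewrite actrN.
rewrite !trT_tadd eA eB eC eD; apply/ffunP=> i; rewrite !ffunE.
by rewrite addrC [RHS]addrACA; congr (_ + _); apply: addrC.
Qed.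

(** Bijectivity comes from the involution and equivariance holds on all tensors, so only the
    matching of [V] with [W] depends on the pair of spaces. *)
Lemma sp4_isomorphic_trT (V W : T -> Prop) :
  (forall f, W (trT f) <-> V f) ->
  sp4_isomorphic (@pi_nl F n) V (@pi_nr F n) W.
Proof.
move=> VW; exists trT; split.
- by move=> f /VW.
- by move=> f1 f2 _ _; apply: inv_inj trTK _ _.
- by move=> g Wg; exists (trT g); [apply/VW; rewrite trTK | rewrite trTK].
- by move=> c f1 f2 _ _; rewrite trT_tadd trT_tscale trZ_cst.
- by move=> X spX f _; apply: trT_pi_nl.
Qed.

End TensorTransposition.

Theorem corollary40 (R : realType) (n : nat) (hn : (0 < n)%N) :
  @sp4_isomorphic R[i] n (@pi_nl R[i] n) (@Fplus R[i] n)
                         (@pi_nr R[i] n) (@Gplus R[i] n) /\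
  @sp4_isomorphic R[i] n (@pi_nl R[i] n) (@Fminus R[i] n)
                         (@pi_nr R[i] n) (@Gminus R[i] n).
Proof.
split; apply: sp4_isomorphic_trT => f; [exact: Gplus_trT | exact: Gminus_trT].
Qed.
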